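(* There is an absolute constant $C$ such that for every $n$ and every $(\theta,m)$-LTF $f\colon\{0,1\}^n\to\{0,1\}$ with $\theta\ge2m>0$, $R^{lin}_{1/3}(f)\le C\frac{\theta}{m}\log\frac{\theta}{m}$ (in particular the bound does not depend on $n$).
   Context: $\mathrm{sgn}(y)=0$ for $y<0$ and $\mathrm{sgn}(y)=1$ for $y\ge0$. A $(\theta,m)$-LTF is a function $f(x)=\mathrm{sgn}(-\theta+\sum_{i=1}^n w_ix_i)$ on $\{0,1\}^n$ with real weights $w_i\ge0$ and real threshold $\theta$, whose margin $m>0$ satisfies $m\le\min_{x\in\{0,1\}^n}|-\theta+\sum_{i=1}^nw_ix_i|$. For $S\subseteq[n]$, $\chi_S(x)=\sum_{i\in S}x_i\pmod2$. Exact randomized $\mathbb F_2$-sketch complexity: for $f\colon\mathbb F_2^n\to\mathbb R$ and $\delta\in[0,1]$, $R^{lin}_\delta(f)$ is the smallest integer $k$ such that there exists a probability distribution over $k$-tuples of subsets $\mathbf S_1,\dots,\mathbf S_k\subseteq[n]$ and a function $g\colon\mathbb F_2^k\to\mathbb R$ with $\Pr_{\mathbf S_1,\dots,\mathbf S_k}[g(\chi_{\mathbf S_1}(x),\dots,\chi_{\mathbf S_k}(x))=f(x)]\ge1-\delta$ for every $x\in\mathbb F_2^n$. *)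

(* Defs.v *)
From mathcomp Require Import all_boot.
From Stdlib Require Import Reals.
Set Implicit Arguments. Unset Strict Implicit. Unset Printing Implicit Defensive.

Local Open Scope R_scope.

Definition sgn (y : R) : R := if Rle_dec 0 y then 1 else 0.

Definition cube (n : nat) := {ffun 'I_n -> bool}.

Definition ltf_arg (n : nat) (w : 'I_n -> R) (theta : R) (x : cube n) : R :=
  - theta + \big[Rplus/0]_(i < n) (if x i then w i else 0).

Definition ltf (n : nat) (w : 'I_n -> R) (theta : R) (x : cube n) : R :=
  sgn (ltf_arg w theta x).

Definition is_theta_m_LTF (n : nat) (w : 'I_n -> R) (theta m : R) : Prop :=
  (forall i, 0 <= w i) /\ 0 < m /\
  (forall x : cube n, m <= Rabs (ltf_arg w theta x)).

Definition chi (n : nat) (S : {set 'I_n}) (x : cube n) : bool :=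
  odd #|[set i in S | x i]|.

Definition is_distr (T : finType) (p : T -> R) : Prop :=
  (forall t, 0 <= p t) /\ \big[Rplus/0]_(t : T) p t = 1.

Definition prob (T : finType) (p : T -> R) (E : T -> Prop)
    (dec : forall t, {E t} + {~ E t}) : R :=
  \big[Rplus/0]_(t : T) (if dec t then p t else 0).

Definition lin_sketch_ok (n : nat) (f : cube n -> R) (delta : R) (k : nat)
  : Prop :=
  exists (p : {ffun 'I_k -> {set 'I_n}} -> R) (g : {ffun 'I_k -> bool} -> R),
    is_distr p /\
    forall x : cube n,
      1 - delta <=
      prob p (fun S => Req_EM_T (g [ffun j => chi (S j) x]) (f x)).

(* R^lin_delta(f) <= B  <->  the least k with lin_sketch_ok is <= B,
   i.e. some k <= B is admissible. *)
Definition Rlin_le (n : nat) (f : cube n -> R) (delta : R) (B : R) : Prop :=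
  exists k : nat, lin_sketch_ok f delta k /\ INR k <= B.

(* Main.v *)
(** Put [q = theta / m] and pick [l] with [2 ^ l <= q <= 2 ^ l.+1].  No partial
    sum falls in the gap of width [2 * m] around [theta], so coordinates lighter
    than [2 * m] never matter, the others may be capped and rounded to integers
    up to [4 ^ l.+1], and a light input has at most [2 ^ l] relevant ones.

    The sketch hashes each relevant coordinate to a uniform cell of a table
    whose row is its integer weight, and records the XOR of the code words of
    the occupied cells.  The code is deterministic, with distinct XORs for
    distinct sets of at most [2 ^ l.+2] cells, so the decoder need not know the
    hash: it answers 0 iff what it sees is the syndrome of a light set.  Inputs
    with few ones are decoded correctly unless two ones collide; for the others,
    the syndrome of [2 ^ l.+2] freshly hashed ones has enough entropy to avoid
    the few light syndromes.  The table has [2 ^ O(l)] cells, hence code words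
    of length [O(l * 2 ^ l)] suffice by a union bound. *)

From HB Require Import structures.
From Stdlib Require Import Reals ZArith Lra.
From mathcomp Require Import all_boot ssralg zify.
Require Import Defs.
Set Implicit Arguments.
Unset Strict Implicit.
Unset Printing Implicit Defensive.
Import GRing.Theory.

(** * Resampling some coordinates of a uniformly random function *)

Definition overwrite (I J A : finType) (u : J -> I) (h : {ffun I -> A})
    (a : {ffun J -> A}) : {ffun I -> A} :=
  [ffun i => if [pick j | u j == i] is Some j then a j else h i].

Section Overwrite.
Variables (I J A : finType) (u : J -> I).
Hypothesis u_inj : injective u.
Implicit Types (h : {ffun I -> A}) (a : {ffun J -> A}).

Lemma overwrite_at h a j : overwrite u h a (u j) = a j.
Proof.
rewrite ffunE; case: pickP => [j' /eqP/u_inj -> // | /(_ j)].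
by rewrite eqxx.
Qed.

Lemma overwrite_out h a i : i \notin codom u -> overwrite u h a i = h i.
Proof.
move=> iNu; rewrite ffunE; case: pickP => // j /eqP ij.
by rewrite -ij codom_f in iNu.
Qed.

Lemma overwriteK h a :
  overwrite u (overwrite u h a) [ffun j => h (u j)] = h.
Proof.
apply/ffunP => i; have [/codomP[j ->]|iNu] := boolP (i \in codom u).
  by rewrite overwrite_at ffunE.
by rewrite !overwrite_out.
Qed.

(* Resampling the coordinates in the image of [u] preserves the uniform
   measure, because [(h, a) |-> (overwrite u h a, h \o u)] is an involution. *)
Lemma card_resample (P : pred {ffun I -> A}) b :
  (forall h, #|[set a | P (overwrite u h a)]| <= b) ->
  #|[set h | P h]| * #|A| ^ #|J| <= #|A| ^ #|I| * b.
Proof.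
move=> Pb; pose s (ha : {ffun I -> A} * {ffun J -> A}) :=
  (overwrite u ha.1 ha.2, [ffun j => ha.1 (u j)]).
have sK : involutive s.
  case=> h a; rewrite /s /= overwriteK; congr (_, _).
  by apply/ffunP => j; rewrite ffunE overwrite_at.
have -> : #|[set h | P h]| * #|A| ^ #|J| =
          \sum_(ha : {ffun I -> A} * {ffun J -> A}) P ha.1.
  rewrite -(pair_big predT predT (fun h (a : {ffun J -> A}) => nat_of_bool (P h))).
  under eq_bigr do rewrite sum_nat_const card_ffun.
  rewrite -big_distrr /= mulnC; congr (_ * _).
  by rewrite -big_mkcond /= sum1dep_card.
rewrite (reindex_inj (inv_inj sK)) /=.
rewrite -(pair_big predT predT (fun h a => nat_of_bool (P (overwrite u h a)))).
rewrite -card_ffun -sum_nat_const; apply: leq_sum => h _.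
by rewrite -big_mkcond /= sum1dep_card.
Qed.

End Overwrite.

(** * Binary codes whose syndromes tell small sets apart *)

Lemma card_bigcup_le (I T : finType) (P : pred I) (F : I -> {set T}) b :
  (forall i, P i -> #|F i| <= b) -> #|\bigcup_(i | P i) F i| <= #|P| * b.
Proof.
move=> Fb; rewrite -sum_nat_const; elim/big_ind2: _ => //; first by rewrite cards0.
by move=> A x B y Ax By; apply: leq_trans (leq_card_setU _ _) (leq_add Ax By).
Qed.

(** Listing the elements of such a set and padding with [None] gives a [d]-tuple over [option E],
    from which the set is recovered. *)
Lemma card_small_sets (E : finType) d :
  #|[set Y : {set E} | #|Y| <= d]| <= #|E|.+1 ^ d.
Proof.
pose F (f : {ffun 'I_d -> option E}) := [set e | Some e \in codom f].
have sub : [set Y : {set E} | #|Y| <= d] \subset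
           [set F f | f in [set: {ffun 'I_d -> option E}]].
  apply/subsetP => Y; rewrite inE => Yd; apply/imsetP.
  exists [ffun j : 'I_d => nth None (map Some (enum Y)) j]; rewrite ?inE //.
  apply/setP => e; rewrite inE; apply/idP/codomP => [eY|[j]].
    have lt_e : index e (enum Y) < d.
      by apply: leq_trans Yd; rewrite cardE index_mem mem_enum.
    exists (Ordinal lt_e); rewrite ffunE /= (nth_map e) ?nth_index ?index_mem //;
    by rewrite mem_enum.
  rewrite ffunE => eE; have [lt_j|ge_j] := ltnP j (size (enum Y)).
    by move: eE; rewrite (nth_map e) // => -[->]; rewrite -mem_enum mem_nth.
  by move: eE; rewrite nth_default // size_map.
apply: leq_trans (subset_leq_card sub) (leq_trans (leq_imset_card _ _) _).
by rewrite cardsT card_ffun card_option card_ord.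
Qed.

Local Open Scope ring_scope.

Definition syndrome (E : finType) (V : zmodType) (H : E -> V) (Y : {set E}) : V :=
  \sum_(e in Y) H e.

(** Union bound over a random [H]. For nonempty [Y], pick [e] in [Y] and resample [H e]: with the
    other code words fixed, at most one of the [2 ^ k] values makes the syndrome vanish. So each [Y]
    rules out at most a [2 ^ k]-th of all codes. *)
Lemma exists_independent_code (E : finType) (k d : nat) :
  (#|E|.+1 ^ d <= 2 ^ k)%N ->
  exists H : E -> {ffun 'I_k -> bool}, forall Y : {set E},
    Y != set0 -> (#|Y| <= d)%N -> syndrome H Y != 0.
Proof.
move=> Ek; pose V := {ffun 'I_k -> bool}.
have cV : #|V| = (2 ^ k)%N by rewrite card_ffun card_bool card_ord.
have cVE : #|{ffun E -> V}| = ((2 ^ k) ^ #|E|)%N by rewrite card_ffun cV.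
pose bad Y := [set H : {ffun E -> V} | syndrome H Y == 0].
pose P := [pred Y : {set E} | (Y != set0) && (#|Y| <= d)%N].
have cbad Y : P Y -> (#|bad Y| * 2 ^ k <= (2 ^ k) ^ #|E|)%N.
  case/andP => /set0Pn[e eY] _.
  have u_inj : injective (fun _ : 'I_1 => e) by move=> i j _; rewrite !ord1.
  have := @card_resample _ _ V _ u_inj (fun H => syndrome H Y == 0) 1.
  rewrite card_ord expn1 cV muln1; apply=> H.
  apply/card_le1_eqP => a b; rewrite !inE /syndrome !(big_setD1 _ eY) /=.
  move=> /eqP a0 /eqP b0; apply/ffunP => j; rewrite ord1.
  have out c : \sum_(i in Y :\ e) overwrite (fun _ : 'I_1 => e) H c i =
               \sum_(i in Y :\ e) H i.
    apply: eq_bigr => i /setD1P[ie _]; rewrite overwrite_out //.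
    by apply/negP => /codomP[? ie']; rewrite ie' eqxx in ie.
  have at_e c : overwrite (fun _ : 'I_1 => e) H c e = c ord0.
    exact: overwrite_at u_inj H c ord0.
  move: a0 b0; rewrite !out !at_e => a0 b0.
  by rewrite (addIr _ (etrans a0 (esym b0))).
(* The inequality is strict because [card_small_sets] also counts the empty set, which [P]
   excludes. *)
have ltP : (#|P| < 2 ^ k)%N.
  apply: leq_trans Ek; apply: leq_trans (card_small_sets E d).
  apply: proper_card; apply/properP; split.
    by apply/subsetP => Y /andP[_]; rewrite inE.
  by exists set0; rewrite !inE ?cards0 // eqxx.
have [H] : exists H, H \notin \bigcup_(Y | P Y) bad Y.
  apply/existsP; rewrite -negb_forall; apply/negP => /forallP allbad.
  have := @card_bigcup_le _ _ P bad ((2 ^ k) ^ #|E| %/ 2 ^ k).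
  have -> : \bigcup_(Y | P Y) bad Y = setT.
    by apply/setP => H; rewrite allbad inE.
  rewrite cardsT cVE leqNgt => /(_ _)/negP[].
    by move=> Y PY; rewrite leq_divRL ?expn_gt0 //; apply: cbad.
  rewrite -(ltn_pmul2r (expn_gt0 2 k)) ?orbT //.
  apply: leq_ltn_trans (_ : _ <= #|P| * (2 ^ k) ^ #|E|)%N _.
    by rewrite -mulnA leq_mul2l leq_divM orbT.
  by rewrite mulnC ltn_pmul2l ?expn_gt0.
move=> HN; exists H => Y Y0 Yd; apply: contra HN => H0.
by apply/bigcupP; exists Y; rewrite ?inE ?Y0.
Qed.

(** In characteristic two, equal syndromes of [Y] and [Z] make the syndrome of their symmetric
    difference zero; that set has at most [d + d] elements, hence is empty. *)
Lemma syndrome_inj (E : finType) (k d : nat) (H : E -> {ffun 'I_k -> bool}) :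
  (forall Y : {set E}, Y != set0 -> (#|Y| <= d + d)%N -> syndrome H Y != 0) ->
  forall Y Z : {set E}, (#|Y| <= d)%N -> (#|Z| <= d)%N ->
  syndrome H Y = syndrome H Z -> Y = Z.
Proof.
move=> indH Y Z Yd Zd eYZ.
have addvv (v : {ffun 'I_k -> bool}) : v + v = 0.
  by apply/ffunP => j; rewrite !ffunE; case: (v j).
apply/eqP; rewrite eqEsubset -!setD_eq0 -setU_eq0; apply/contraT => /indH.
have -> : (#|(Y :\: Z) :|: (Z :\: Y)| <= d + d)%N.
  apply: leq_trans (leq_card_setU _ _) (leq_add _ _).
    exact: leq_trans (subset_leq_card (subsetDl _ _)) Yd.
  exact: leq_trans (subset_leq_card (subsetDl _ _)) Zd.
move/(_ isT)/eqP; case; rewrite /syndrome (big_setID Y) /=.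
have -> : (Y :\: Z :|: Z :\: Y) :&: Y = Y :\: Z.
  by apply/setP => e; rewrite !inE; case: (e \in Y); case: (e \in Z).
have -> : (Y :\: Z :|: Z :\: Y) :\: Y = Z :\: Y.
  by apply/setP => e; rewrite !inE; case: (e \in Y); case: (e \in Z).
move: eYZ; rewrite /syndrome (big_setID Z) /= [in RHS](big_setID Y) /= setIC.
by move/addrI => ->; rewrite addvv.
Qed.

(** * Random hashing into a table of code words *)

Section Hashing.
Variables (I C A : finType) (c : I -> C) (k T : nat).
Variable H : C * A -> {ffun 'I_k -> bool}.
Hypothesis H_inj : forall Y Z : {set C * A}, (#|Y| <= T)%N -> (#|Z| <= T)%N ->
  syndrome H Y = syndrome H Z -> Y = Z.
Implicit Types (h : {ffun I -> A}) (U X : {set I}).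

Definition cell h i : C * A := (c i, h i).

(** The sum runs over coordinates and not over cells, so two coordinates in the same cell cancel. It
    is the syndrome of the occupied cells when there is no collision. *)
Definition sketch h X : {ffun 'I_k -> bool} := \sum_(i in X) H (cell h i).

Definition separates h U :=
  [forall i in U, forall j in U, (cell h i == cell h j) ==> (i == j)].

Lemma separatesP h U : reflect {in U &, injective (cell h)} (separates h U).
Proof.
apply: (iffP forall_inP) => [sep i j iU jU e|inj i iU].
  by apply/eqP; move/forall_inP/(_ j jU)/implyP: (sep i iU); apply; apply/eqP.
by apply/forall_inP => j jU; apply/implyP => /eqP/inj ->.
Qed.

Lemma sketch_syndrome h X :
  separates h X -> sketch h X = syndrome H (cell h @: X).
Proof. by move/separatesP=> inj; rewrite /syndrome big_imset. Qed.

(** Union bound over ordered pairs of distinct coordinates: a shared cell forces equal hash values,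
    which happens for at most one value of the resampled [h i]. *)
Lemma card_collisions U :
  (#|[set h | ~~ separates h U]| * #|A| <= #|U| ^ 2 * #|A| ^ #|I|)%N.
Proof.
have [A0|A0] := posnP #|A|; first by rewrite A0 muln0.
pose P := [pred ij : I * I | [&& ij.1 \in U, ij.2 \in U & ij.1 != ij.2]].
pose F (ij : I * I) := [set h : {ffun I -> A} | h ij.1 == h ij.2].
have cF ij : P ij -> (#|F ij| <= #|A| ^ #|I| %/ #|A|)%N.
  case: ij => i j /and3P[/= _ _ ij]; rewrite leq_divRL //.
  have u_inj : injective (fun _ : 'I_1 => i) by move=> a b _; rewrite !ord1.
  have := @card_resample _ _ A _ u_inj (fun h => h i == h j) 1.
  rewrite card_ord expn1 muln1; apply=> h.
  have at_i a : overwrite (fun _ : 'I_1 => i) h a i = a ord0.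
    exact: overwrite_at u_inj h a ord0.
  have at_j a : overwrite (fun _ : 'I_1 => i) h a j = h j.
    by rewrite overwrite_out //; apply/negP => /codomP[_ /esym/eqP]; rewrite (negPf ij).
  apply/card_le1_eqP => a b; rewrite !inE !at_i !at_j => /eqP a0 /eqP b0.
  by apply/ffunP => z; rewrite ord1 a0 b0.
have sub : [set h | ~~ separates h U] \subset \bigcup_(ij | P ij) F ij.
  apply/subsetP => h; rewrite inE => /forall_inPn[i iU /forall_inPn[j jU]].
  rewrite negb_imply => /andP[/eqP[_ hij] ij].
  by apply/bigcupP; exists (i, j); rewrite ?inE /= ?iU ?jU ?ij ?hij.
have cP : (#|P| <= #|U| ^ 2)%N.
  rewrite -mulnn -cardsX; apply/subset_leq_card/subsetP => -[i j].
  by rewrite !inE /= => /and3P[-> ->].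
have := leq_trans (subset_leq_card sub) (card_bigcup_le cF).
rewrite -(leq_pmul2r A0) => /leq_trans; apply.
by rewrite -mulnA leq_mul // leq_divM.
Qed.

(* A set of at most [T] cells is determined by its syndrome, so a prescribed
   syndrome leaves at most [#|U|] candidate hash values for each separated
   coordinate in [U]. *)
Lemma card_separated_hits U X (B : {set {set C * A}}) :
  U \subset X -> (#|U| <= T)%N ->
  (#|[set h | separates h U && (sketch h X \in [set syndrome H Y | Y in B])]|
     * #|A| ^ #|U| <= #|A| ^ #|I| * (#|B| * #|U| ^ #|U|))%N.
Proof.
move=> UX cU.
pose u (j : 'I_#|U|) : I := enum_val j.
have u_inj : injective u := enum_val_inj.
have uU j : u j \in U by apply: enum_valP.
have codom_u i : (i \in codom u) = (i \in U).
  apply/codomP/idP => [[j ->] //|iU].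
  by exists (enum_rank_in iU i); rewrite /u enum_rankK_in.
have := @card_resample _ _ A u u_inj
  (fun h => separates h U && (sketch h X \in [set syndrome H Y | Y in B])).
rewrite card_ord; apply=> h.
(* The contribution of the coordinates outside [U] is unaffected by the resampling, so it acts as a
   constant shift. *)
pose r := \sum_(i in X :\: U) H (cell h i).
pose im (a : {ffun 'I_#|U| -> A}) := [set (c (u j), a j) | j : 'I_#|U|].
have sepE a : separates (overwrite u h a) U -> injective (fun j => (c (u j), a j)).
  move/separatesP => sep i j e; apply/u_inj/sep; rewrite ?uU //.
  by rewrite /cell !overwrite_at.
have skE a : separates (overwrite u h a) U ->
    sketch (overwrite u h a) X = syndrome H (im a) + r.
  move=> sep; rewrite /sketch (big_setID U) /= (setIidPr UX); congr (_ + _).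
    rewrite /syndrome big_imset /=; last by move=> i j _ _; apply: sepE.
    by rewrite big_enum_val; apply: eq_bigr => j _; rewrite /cell overwrite_at.
  apply: eq_bigr => i /setDP[_ iU].
  by rewrite /cell overwrite_out // codom_u.
pose G (Y : {set C * A}) :=
  [set a | separates (overwrite u h a) U &&
           (syndrome H (im a) + r == syndrome H Y)].
have cG Y : Y \in B -> (#|G Y| <= #|U| ^ #|U|)%N.
  move=> _; have [->|[a0]] := set_0Vmem (G Y); first by rewrite cards0.
  rewrite inE => /andP[sep0 /eqP e0].
  (* Any other [a] in [G Y] occupies the same cells as [a0], by injectivity of syndromes, so it
     takes its values among the at most [#|U|] values of [a0]. *)
  pose R := [set a : {ffun 'I_#|U| -> A} | a \in ffun_on (codom a0)].
  apply: (@leq_trans #|R|); last first.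
    have leX e x y : (x <= y)%N -> (x ^ e <= y ^ e)%N.
      by case: e => // e xy; rewrite leq_exp2r.
    rewrite cardsE card_ffun_on card_ord leX //.
    by rewrite -[X in (_ <= X)%N]card_ord leq_image_card.
  apply/subset_leq_card/subsetP => a; rewrite !inE => /andP[sep /eqP e].
  have cim b : (#|im b| <= T)%N.
    by apply: leq_trans (leq_imset_card _ _) _; rewrite card_ord.
  have imE : im a = im a0.
    by apply: H_inj => //; apply: addIr (etrans e (esym e0)).
  apply/ffun_onP => j.
  have : (c (u j), a j) \in im a0 by rewrite -imE imset_f.
  by case/imsetP => j' _ [_ ->]; apply: codom_f.
apply: leq_trans (card_bigcup_le cG); apply/subset_leq_card/subsetP => a.
rewrite inE => /andP[sep]; rewrite (skE _ sep) => /imsetP[Y YB e].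
by apply/bigcupP; exists Y; rewrite ?inE ?sep ?e ?eqxx.
Qed.
End Hashing.

(** * The randomized sketch for an integer threshold *)

Section IntegerThreshold.
Variables (n l : nat) (c : 'I_n -> nat) (K : nat).
Hypothesis c_le : forall i, (c i <= (2 ^ l.+1) ^ 2)%N.
Hypothesis light_small : forall X : {set 'I_n},
  (\sum_(i in X) c i <= K)%N -> (#|[set i in X | 0 < c i]| <= 2 ^ l)%N.

(** [T] is four times the bound on the relevant part of a light set. [A] has [8 * T ^ 2] elements,
    so [T] coordinates collide with probability at most 1/8. [k] is [2 * T] times the bound
    [4 * l + 11] on the binary logarithm of the number of cells plus one, as the code for
    [d = T + T] requires. *)
Let T := (2 ^ l.+2)%N.
Let A := 'I_(2 ^ (2 * l + 7)).
Let C := 'I_((2 ^ l.+1) ^ 2).+1.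
Let k := ((4 * l + 11) * 2 ^ l.+3)%N.
Let cl i : C := inord (c i).

Let clE i : cl i = c i :> nat.
Proof. by rewrite inordK // ltnS c_le. Qed.

Lemma card_cells : (#|{: C * A}|.+1 <= 2 ^ (4 * l + 11))%N.
Proof.
rewrite card_prod !card_ord -expnM.
(* The last summand is a spare factor 4, which absorbs the extra row of weight 0 and the final
   successor. *)
have -> : (4 * l + 11 = (l.+1 * 2 + (2 * l + 7)) + 2)%N by lia.
rewrite (expnD 2 (_ + _) 2) (expnD 2 (l.+1 * 2)).
set a := (2 ^ (l.+1 * 2))%N; set b := (2 ^ (2 * l + 7))%N.
have a0 : (0 < a)%N by rewrite expn_gt0.
have b0 : (0 < b)%N by rewrite expn_gt0.
have := leq_pmull b a0; rewrite mulSn (_ : 2 ^ 2 = 4)%N //.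
move: (a * b)%N => ab; lia.
Qed.

Lemma exists_counting_sketch :
  exists (S : {ffun 'I_n -> A} -> 'I_k -> {set 'I_n}) (g : {ffun 'I_k -> bool} -> bool),
    forall x : cube n,
      (3 * #|[set h | g [ffun j => chi (S h j) x] != (K < \sum_(i | x i) c i)]|
         <= #|{ffun 'I_n -> A}|)%N.
Proof.
have T2 : (T + T = 2 ^ l.+3)%N by rewrite /T addnn -mul2n -expnS.
have [H indH] : exists H : C * A -> {ffun 'I_k -> bool}, forall Y : {set C * A},
    Y != set0 -> (#|Y| <= T + T)%N -> syndrome H Y != 0.
  apply: exists_independent_code; rewrite T2 /k expnM.
  by rewrite leq_exp2r ?expn_gt0 // card_cells.
have H_inj := syndrome_inj indH.
(* The table contents that a light input can produce without collision: the row of a cell is its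
   weight, so lightness can be read off the cells alone. *)
pose B := [set Y : {set C * A} | (#|Y| <= 2 ^ l)%N & (\sum_(e in Y) e.1 <= K)%N].
exists (fun h j => [set i | (0 < c i)%N && H (cell cl h i) j]).
exists (fun z => z \notin [set syndrome H Y | Y in B]) => x.
set X := [set i | x i & (0 < c i)%N].
have sumX : (\sum_(i | x i) c i = \sum_(i in X) c i)%N.
  rewrite (bigID (fun i => 0 < c i)%N) /= [X in (_ + X)%N]big1 ?addn0; last first.
    by move=> i /andP[_]; rewrite lt0n negbK => /eqP.
  by apply: eq_bigl => i; rewrite inE.
have smallX : (\sum_(i in X) c i <= K)%N -> (#|X| <= 2 ^ l)%N.
  move/light_small; congr (_ <= _)%N; apply: eq_card => i.
  by rewrite !inE -andbA andbb.
(* The [j]-th parity adds the [j]-th bits of the code words of the relevant ones of [x], so the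
   parities together form the sketch. *)
have skE h : [ffun j => chi [set i | (0 < c i)%N && H (cell cl h i) j] x] =
             sketch cl H h X.
  apply/ffunP => j; rewrite ffunE /sketch sum_ffunE /chi.
  rewrite -sum1dep_card (big_morph odd oddD (erefl (odd 0))) big_mkcond [RHS]big_mkcond.
  apply: eq_bigr => i _; rewrite !inE.
  by case: (x i); case: (0 < c i)%N; case: (H _ j).
under eq_finset do rewrite skE.
have t_le_T : (2 ^ l <= T)%N by rewrite leq_exp2l // ltnW.
have A0 : (0 < #|A|)%N by rewrite card_ord expn_gt0.
have cA : #|A| = (2 ^ (2 * l + 7))%N by rewrite card_ord.
pose coll (U : {set 'I_n}) := [set h : {ffun 'I_n -> A} | ~~ separates cl h U].
have coll_le (U : {set 'I_n}) : (#|U| <= T)%N -> (8 * #|coll U| <= #|A| ^ n)%N.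
  move=> UT; have := @card_collisions _ _ A cl U; rewrite -/(coll U).
  rewrite [#|'I_n|]card_ord -(leq_pmul2l (isT : 0 < 8)%N) mulnA => le1.
  rewrite -(leq_pmul2r A0); apply: leq_trans le1 _.
  have -> : #|A| = (8 * T ^ 2)%N.
    by rewrite cA /T -expnM -[8%N]/(2 ^ 3)%N -expnD; congr (2 ^ _)%N; lia.
  by rewrite [X in (_ <= X)%N]mulnC -mulnA leq_mul2l leq_mul2r leq_exp2r // UT orbT.
(* With [t = 2 ^ l] and [T = 4 * t], the binary logarithms are at most [4 + (8 * l + 19) * t] on the
   left and equal to [(8 * l + 28) * t] on the right. *)
have B_le : (16 * (#|B| * T ^ T) <= #|A| ^ T)%N.
  have lB : (#|B| <= 2 ^ ((4 * l + 11) * 2 ^ l))%N.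
    apply: leq_trans (_ : #|{: C * A}|.+1 ^ (2 ^ l) <= _)%N.
      apply: leq_trans (card_small_sets _ _); apply: subset_leq_card.
      by apply/subsetP => Y; rewrite !inE => /andP[].
    by rewrite expnM leq_exp2r ?expn_gt0 // card_cells.
  have TE : T = (4 * 2 ^ l)%N by rewrite /T !expnS mulnA.
  have TT : (T ^ T = 2 ^ (l.+2 * T))%N by rewrite expnM.
  rewrite cA TT -(expnM 2 (2 * l + 7)).
  apply: (@leq_trans (2 ^ 4 * (2 ^ ((4 * l + 11) * 2 ^ l) * 2 ^ (l.+2 * T)))%N).
    by rewrite leq_mul2l /= leq_mul2r lB orbT.
  rewrite -!expnD leq_exp2l // TE.
  have : (0 < 2 ^ l)%N by rewrite expn_gt0.
  by move: (2 ^ l)%N => t; nia.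
have cN : #|{ffun 'I_n -> A}| = (#|A| ^ n)%N.
  by rewrite card_ffun [#|'I_n|]card_ord.
(* If [X] has at most [T] elements, its cells and every member of [B] lie in the range where
   syndromes are injective, so only a collision causes an error. *)
rewrite cN; have [XT|XT] := leqP #|X| T.
  apply: leq_trans (coll_le _ XT).
  apply: leq_mul => //; apply/subset_leq_card/subsetP => h.
  rewrite !inE; apply: contraNN => sep.
  rewrite (sketch_syndrome _ sep) sumX.
  have cell_inj := separatesP _ _ _ sep.
  have sumY : (\sum_(e in cell cl h @: X) e.1 = \sum_(i in X) c i)%N.
    by rewrite big_imset //=; apply: eq_bigr => i _; rewrite clE.
  have cardY : #|cell cl h @: X| = #|X| by rewrite card_in_imset.
  apply/eqP; rewrite ltnNge; congr negb; apply/imsetP/idP => [[Y]|sumK].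
    rewrite inE => /andP[Yt YK] /H_inj YE; rewrite -sumY YE ?cardY //.
    exact: leq_trans Yt t_le_T.
  by exists (cell cl h @: X); rewrite // inE cardY sumY sumK smallX.
have heavy : (K < \sum_(i | x i) c i)%N.
  rewrite ltnNge sumX; apply: contraL XT => /smallX Xt.
  by rewrite -leqNgt (leq_trans Xt).
rewrite heavy.
have [U UX UT] : exists2 U : {set 'I_n}, U \subset X & #|U| = T.
  exists [set i in take T (enum X)].
    by apply/subsetP => i; rewrite inE => /mem_take; rewrite mem_enum.
  rewrite cardsE (card_uniqP _) ?take_uniq ?enum_uniq //.
  by rewrite size_take -cardE XT.
(* Now the input is heavy, and an error means that the sketch is a light syndrome: either [U] has a
   collision, or [h] is in [hits]. *)
pose hits := [set h : {ffun 'I_n -> A} |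
  separates cl h U && (sketch cl H h X \in [set syndrome H Y | Y in B])].
have hits_le : (16 * #|hits| <= #|A| ^ n)%N.
  have := @card_separated_hits _ _ A cl _ _ H H_inj U X B UX (eq_leq UT).
  rewrite -/hits UT [#|'I_n|]card_ord => le1.
  have AT : (0 < #|A| ^ T)%N by rewrite expn_gt0 A0.
  rewrite -(leq_pmul2r AT) -mulnA; apply: leq_trans (leq_mul (leqnn 16) le1) _.
  by rewrite mulnCA leq_mul2l B_le orbT.
apply: leq_trans (_ : 3 * (#|coll U| + #|hits|) <= _)%N.
  apply: leq_mul => //; apply: leq_trans (leq_card_setU _ _).
  apply/subset_leq_card/subsetP => h; rewrite !inE eqb_id negbK => ->.
  by rewrite andbT orNb.
(* The error probability is at most 1/8 + 1/16, below 1/3. *)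
have := coll_le U (eq_leq UT).
move: hits_le.
by move: (#|A| ^ n)%N => N; lia.
Qed.
End IntegerThreshold.

Local Close Scope ring_scope.

Local Open Scope R_scope.

(** * Real sums, integer parts and uniform distributions *)

Lemma RplusA : associative Rplus.
Proof. by move=> x y z; rewrite Rplus_assoc. Qed.

HB.instance Definition _ :=
  Monoid.isComLaw.Build R 0 Rplus RplusA Rplus_comm Rplus_0_l.

Lemma sumR_le (I : finType) (P : pred I) (F G : I -> R) :
  (forall i, P i -> F i <= G i) ->
  \big[Rplus/0]_(i | P i) F i <= \big[Rplus/0]_(i | P i) G i.
Proof.
move=> FG; elim/big_ind2: _ => //; first exact: Rle_refl.
by move=> *; apply: Rplus_le_compat.
Qed.

Lemma sumR_mulr (I : finType) (P : pred I) (F : I -> R) r :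
  \big[Rplus/0]_(i | P i) (F i * r) = (\big[Rplus/0]_(i | P i) F i) * r.
Proof.
apply: (big_rec2 (fun x y => x = y * r)); first by rewrite Rmult_0_l.
by move=> i x y _ ->; ring.
Qed.

Lemma INR_addn a b : INR (a + b)%N = INR a + INR b.
Proof. by rewrite -plus_INR. Qed.

Lemma INR_muln a b : INR (a * b)%N = INR a * INR b.
Proof. by rewrite -mult_INR. Qed.

Lemma INR_exp2 l : INR (2 ^ l)%N = 2 ^ l.
Proof. by elim: l => [|l IH]; rewrite ?expn0 // expnS INR_muln IH. Qed.

Lemma INR_leq a b : (a <= b)%N -> INR a <= INR b.
Proof. by move/leP/le_INR. Qed.

Lemma leq_INR a b : INR a < INR b + 1 -> (a <= b)%N.
Proof. by rewrite -S_INR => /INR_lt ab; rewrite -ltnS; apply/ltP. Qed.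

Lemma INR_sum (I : finType) (P : pred I) (F : I -> nat) :
  INR (\sum_(i | P i) F i)%N = \big[Rplus/0]_(i | P i) INR (F i).
Proof. exact: (big_morph INR INR_addn). Qed.

Lemma sumR_const (I : finType) (P : pred I) r :
  \big[Rplus/0]_(i | P i) r = INR #|[set i | P i]| * r.
Proof.
rewrite -sum1dep_card INR_sum -sumR_mulr; apply: eq_bigr => i _ /=.
by rewrite Rmult_1_l.
Qed.

Definition nfloor (r : R) : nat := Z.to_nat (Int_part r).

Lemma nfloorP r : 0 <= r -> INR (nfloor r) <= r < INR (nfloor r) + 1.
Proof.
move=> r0; have [le1 gt1] := base_Int_part r.
have Z0 : (0 <= Int_part r)%Z.
  by apply: (proj1 (Z.lt_succ_r _ _)); apply: lt_IZR; rewrite succ_IZR; lra.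
rewrite /nfloor INR_IZR_INZ Z2Nat.id //; lra.
Qed.

(** Passes from counting seeds [h] to a distribution on tuples of subsets: the image of the uniform
    distribution under [S], where several seeds may give the same tuple. *)
Lemma uniform_lin_sketch (n k : nat) (b : cube n -> bool) (f : cube n -> R)
    (T : finType) (S : T -> 'I_k -> {set 'I_n}) (g : {ffun 'I_k -> bool} -> bool) :
  (0 < #|T|)%N -> (forall x, f x = if b x then 1 else 0) ->
  (forall x, (3 * #|[set h | g [ffun j => chi (S h j) x] != b x]| <= #|T|)%N) ->
  lin_sketch_ok f (1 / 3) k.
Proof.
move=> T0 fb err; pose r := / INR #|T|; pose F h := [ffun j => S h j].
have N0 : 0 < INR #|T| by apply: lt_0_INR; apply/ltP.
have r0 : 0 < r by apply: Rinv_0_lt_compat.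
have Nr : INR #|T| * r = 1 by rewrite /r Rinv_r //; lra.
(* The mass of an event under the image distribution is the fraction of seeds landing in it. *)
have pushE (G : {ffun 'I_k -> {set 'I_n}} -> bool) :
    \big[Rplus/0]_s (if G s then \big[Rplus/0]_(h | F h == s) r else 0) =
    INR #|[set h | G (F h)]| * r.
  rewrite -big_mkcond /= (exchange_big_dep xpredT) //= -sumR_const.
  rewrite [RHS]big_mkcond; apply: eq_bigr => h _.
  have [GF|GF] := boolP (G (F h)).
    by rewrite (big_pred1 (F h)) // => s; rewrite eq_sym /= andb_idl // => /eqP ->.
  by rewrite big_pred0 // => s; apply/negP => /andP[Gs /eqP Fh]; rewrite Fh Gs in GF.
exists (fun s => \big[Rplus/0]_(h | F h == s) r).
exists (fun z => if g z then 1 else 0); split.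
  split; first by move=> s; rewrite sumR_const; have := pos_INR #|[set h | F h == s]|; nra.
  have := pushE xpredT; rewrite cardsT Nr => <-; exact: eq_bigr.
move=> x; pose G (s : {ffun 'I_k -> {set 'I_n}}) := g [ffun j => chi (s j) x] == b x.
rewrite /prob (eq_bigr (fun s => if G s then \big[Rplus/0]_(h | F h == s) r else 0)).
  rewrite pushE.
  pose E := [set h | g [ffun j => chi (S h j) x] != b x].
  have GE : [set h | G (F h)] = ~: E.
    apply/setP => h; rewrite !inE negbK /G; congr (g _ == _).
    by apply/ffunP => j; rewrite !ffunE.
  have le1 : 3 * INR #|E| <= INR #|T|.
    by have := INR_leq (err x); rewrite INR_muln -/E /=; lra.
  have eqC : INR #|E| + INR #|~: E| = INR #|T| by rewrite -INR_addn cardsC.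
  apply: (Rmult_le_reg_l (INR #|T|)) => //.
  by rewrite GE (Rmult_comm _ r) -Rmult_assoc Nr; lra.
move=> s _; rewrite /G fb; case: (g _); case: (b x); case: Req_EM_T => //=; lra.
Qed.

(** * Rounding the real weights to integers *)

Section Discretize.
Variables (n l : nat) (w : 'I_n -> R) (theta m : R).
Hypothesis LTF : is_theta_m_LTF w theta m.
Hypothesis theta_le : theta <= INR (2 ^ l.+1)%N * m.
Hypothesis theta_ge : 2 * m <= theta.

Implicit Types X : {set 'I_n}.
Let D := (2 ^ l.+1)%N.

Definition weight (X : {set 'I_n}) : R := \big[Rplus/0]_(i in X) w i.

(** Scaling by [D / m] turns the gap of width [2 * m] into one of width [2 * D], leaving room for
    rounding losses. Since [theta <= D * m], the scaled threshold is at most [D ^ 2], so a weight at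
    the cap is heavy by itself. *)
Definition iweight (i : 'I_n) : nat :=
  if Rlt_dec (w i) (2 * m) then 0%N else minn (nfloor (w i * (INR D / m))) (D ^ 2).

(** Placed at the lower end of the gap: rounding and capping only decrease weights, so light sets
    stay below it. *)
Definition ithreshold : nat := nfloor ((theta - m) * (INR D / m)).

Let w_ge0 i : 0 <= w i. Proof. by case: LTF. Qed.
Let m_gt0 : 0 < m. Proof. by case: LTF => _ []. Qed.

Let D_ge2 : (2 <= D)%N.
Proof. by rewrite /D expnS leq_pmulr ?expn_gt0. Qed.

Let RD_ge2 : 2 <= INR D. Proof. exact: (INR_leq D_ge2). Qed.

Let Dm_gt0 : 0 < INR D / m.
Proof. by apply: Rdiv_lt_0_compat => //; lra. Qed.

Let Dm_m : m * (INR D / m) = INR D.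
Proof. by field; lra. Qed.

Lemma ltf_arg_weight (x : cube n) : ltf_arg w theta x = weight [set i | x i] - theta.
Proof.
rewrite /ltf_arg /weight -big_mkcond Rplus_comm; congr (_ + _).
by apply: eq_bigl => i; rewrite inE.
Qed.

Lemma weight_margin X : weight X <= theta - m \/ theta + m <= weight X.
Proof.
case: LTF => _ [_ /(_ [ffun i => i \in X])]; rewrite ltf_arg_weight.
have -> : [set i | [ffun i => i \in X] i] = X by apply/setP => i; rewrite inE ffunE.
by rewrite /Rabs; case: Rcase_abs => ?; lra.
Qed.

Lemma iweight_le_sqr i : (iweight i <= D ^ 2)%N.
Proof. by rewrite /iweight; case: Rlt_dec => //= _; apply: geq_minr. Qed.

Lemma iweight_heavy i : 2 * m <= w i -> (2 * D <= iweight i)%N.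
Proof.
move=> wi; rewrite /iweight; case: Rlt_dec => /= [|_]; first lra.
have wD : 2 * INR D <= w i * (INR D / m).
  by rewrite -{1}Dm_m -Rmult_assoc; apply: Rmult_le_compat_r; lra.
rewrite leq_min -mulnn leq_mul2r D_ge2 orbT andbT.
by apply: leq_INR; rewrite INR_muln /=; have := @nfloorP (w i * (INR D / m)); lra.
Qed.

Lemma iweight_gt0 i : (0 < iweight i)%N -> 2 * m <= w i.
Proof. by rewrite /iweight; case: Rlt_dec => //= ? _; lra. Qed.

Lemma iweight_le i : INR (iweight i) <= w i * (INR D / m).
Proof.
have w0 : 0 <= w i * (INR D / m) by apply: Rmult_le_pos => //; lra.
rewrite /iweight; case: Rlt_dec => //= _.
by have := INR_leq (geq_minl (nfloor (w i * (INR D / m))) (D ^ 2)); have := nfloorP w0; lra.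
Qed.

Lemma iweight_floor i : (0 < iweight i)%N -> iweight i <> (D ^ 2)%N ->
  w i * (INR D / m) <= INR (iweight i) + 1.
Proof.
have w0 : 0 <= w i * (INR D / m) by apply: Rmult_le_pos => //; lra.
rewrite /iweight; case: Rlt_dec => //= _ _; rewrite /minn.
by case: ifP => // _ _; have := nfloorP w0; lra.
Qed.

Lemma ithresholdP :
  INR ithreshold <= (theta - m) * (INR D / m) < INR ithreshold + 1.
Proof. by apply: nfloorP; apply: Rmult_le_pos; lra. Qed.

Lemma ithreshold_le : INR ithreshold + INR D <= INR (D ^ 2)%N.
Proof.
have := ithresholdP; rewrite Rmult_minus_distr_r Dm_m => -[leK _].
have : theta * (INR D / m) <= INR D * m * (INR D / m).
  by apply: Rmult_le_compat_r => //; lra.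
by rewrite Rmult_assoc Dm_m -mulnn INR_muln; lra.
Qed.

(* Removing a coordinate lighter than [2 * m] cannot jump over the gap of
   width [2 * m] around [theta]. *)
Lemma heavy_part X : theta + m <= weight X ->
  theta + m <= weight [set i in X | (0 < iweight i)%N].
Proof.
set L := [set i | (0 < iweight i)%N].
have -> : [set i in X | (0 < iweight i)%N] = X :&: L by apply/setP => i; rewrite !inE.
(* Induction on the number of coordinates of [X] that are still to be removed. *)
move: {2}#|X :\: L| (erefl #|X :\: L|) => s.
elim: s X => [|s IH] X.
  move/eqP; rewrite cards_eq0 setD_eq0 => /setIidPl -> //.
move=> cX heavy; have /set0Pn[i] : X :\: L != set0 by rewrite -card_gt0 cX.
rewrite !inE => /andP[iL iX].
have wi : w i < 2 * m.
  by apply: Rnot_le_lt => /iweight_heavy; move: iL; rewrite -eqn0Ngt => /eqP ->; lia.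
have XE : weight X = w i + weight (X :\ i) by rewrite /weight (big_setD1 _ iX).
have -> : X :&: L = (X :\ i) :&: L.
  apply/setP => j; rewrite !inE; have [->|//] := eqVneq j i.
  by rewrite (negPf iL) andbF.
apply: IH; last by case: (weight_margin (X :\ i)) => //; lra.
have -> : (X :\ i) :\: L = (X :\: L) :\ i by apply/setP => j; rewrite !inE andbCA.
by move: cX; rewrite (cardsD1 i) !inE iL iX => -[].
Qed.

Lemma light_iweight X : weight X <= theta - m ->
  (\sum_(i in X) iweight i <= ithreshold)%N.
Proof.
move=> light; apply: leq_INR; have [_ ltK] := ithresholdP.
apply: Rle_lt_trans ltK; rewrite INR_sum.
apply: (Rle_trans _ (weight X * (INR D / m))).
  by rewrite -sumR_mulr; apply: sumR_le => i _; apply: iweight_le.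
by apply: Rmult_le_compat_r; lra.
Qed.

Lemma iweight_card X :
  (#|[set i in X | 0 < iweight i]| * (2 * D) <= \sum_(i in X) iweight i)%N.
Proof.
rewrite (bigID (fun i => 0 < iweight i)%N) /=; apply: leq_trans (leq_addr _ _).
rewrite -sum_nat_const big_mkcond [X in (_ <= X)%N]big_mkcond /=.
apply: leq_sum => i _; rewrite inE; case: ifP => // /andP[_].
by move/iweight_gt0/iweight_heavy.
Qed.

Lemma ithreshold_lt : (ithreshold < D ^ 2)%N.
Proof. by apply: leq_INR; rewrite S_INR; have := ithreshold_le; lra. Qed.

(** Three cases for the relevant part [Y]: one capped coordinate suffices; [2 * D] coordinates of
    integer weight at least [2 * D] suffice; otherwise fewer than [2 * D] roundings lose at most 1
    each, which does not use up the scaled gap [2 * D]. *)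
Lemma heavy_iweight X : theta + m <= weight X ->
  (ithreshold < \sum_(i in X) iweight i)%N.
Proof.
move/heavy_part; set Y := [set i in X | (0 < iweight i)%N] => heavy.
have YX : (\sum_(i in Y) iweight i <= \sum_(i in X) iweight i)%N.
  rewrite [X in (_ <= X)%N](bigID (fun i => 0 < iweight i)%N) /=.
  apply: leq_trans (leq_addr _ _); apply: eq_leq; apply: eq_bigl => i.
  by rewrite inE.
have [capped|uncapped] := boolP [exists i in Y, iweight i == (D ^ 2)%N].
  have [i iY /eqP Di] := exists_inP capped.
  apply: leq_trans YX; apply: leq_trans ithreshold_lt _.
  by rewrite (big_setD1 _ iY) Di leq_addr.
have [big|small] := leqP (2 * D) #|Y|.
  apply: leq_trans ithreshold_lt _; apply: leq_trans (iweight_card X); rewrite -/Y.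
  by nia.
apply: leq_trans YX; apply: leq_INR; rewrite S_INR INR_sum.
have : weight Y * (INR D / m) <= \big[Rplus/0]_(i in Y) INR (iweight i) + INR #|Y|.
  rewrite /weight -sumR_mulr.
  have -> : INR #|Y| = \big[Rplus/0]_(i in Y) 1.
    by rewrite sumR_const Rmult_1_r; congr INR; apply: eq_card => i; rewrite inE.
  rewrite -big_split; apply: sumR_le => i iY; apply: iweight_floor.
    by move: iY; rewrite inE => /andP[].
  by move=> Di; case/negP: uncapped; apply/exists_inP; exists i; rewrite // Di.
have : (theta + m) * (INR D / m) <= weight Y * (INR D / m).
  by apply: Rmult_le_compat_r; lra.
have [leK _] := ithresholdP; move: leK.
rewrite Rmult_minus_distr_r Rmult_plus_distr_r Dm_m.
have : INR #|Y| + 1 <= 2 * INR D.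
  by rewrite -S_INR; have := INR_leq small; rewrite INR_muln.
lra.
Qed.

(** Positive integer weights are at least [2 * D] and the total is below [D ^ 2], so there are at
    most [D / 2 = 2 ^ l] of them. *)
Lemma light_iweight_card X : (\sum_(i in X) iweight i <= ithreshold)%N ->
  (#|[set i in X | 0 < iweight i]| <= 2 ^ l)%N.
Proof.
move=> light; have D0 : (0 < 2 * D)%N by rewrite muln_gt0 expn_gt0.
rewrite -(leq_pmul2r D0); apply: leq_trans (iweight_card X) _.
apply: leq_trans light (leq_trans (ltnW ithreshold_lt) _).
by rewrite -mulnn {1}/D expnS; nia.
Qed.

Lemma ltfE (x : cube n) : ltf w theta x =
  if (ithreshold < \sum_(i | x i) iweight i)%N then 1 else 0.
Proof.
rewrite /ltf /sgn.
have [Y [-> ->]] : exists Y, ltf_arg w theta x = weight Y - theta /\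
    (\sum_(i | x i) iweight i = \sum_(i in Y) iweight i)%N.
  exists [set i | x i]; rewrite ltf_arg_weight; split=> //.
  by apply: eq_bigl => i; rewrite inE.
case: (weight_margin Y) => [light|heavy].
  by rewrite ltnNge light_iweight //; case: Rle_dec => //= ?; lra.
by rewrite heavy_iweight //; case: Rle_dec => //= ?; lra.
Qed.

Lemma ltf_lin_sketch :
  lin_sketch_ok (ltf w theta) (1 / 3) ((4 * l + 11) * 2 ^ l.+3)%N.
Proof.
have [S [g err]] := exists_counting_sketch iweight_le_sqr light_iweight_card.
apply: (uniform_lin_sketch _ ltfE err).
by rewrite card_ffun !card_ord !expn_gt0.
Qed.

End Discretize.

(** * The choice of scale and the final bound *)

Lemma exists_dyadic_scale q : 2 <= q ->
  exists l : nat, (0 < l)%N /\ 2 ^ l <= q <= 2 ^ l.+1.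
Proof.
move=> q2; have q0 : 0 <= q by lra.
have [le_q lt_q] := nfloorP q0.
have N2 : (2 <= nfloor q)%N by apply: leq_INR => /=; lra.
have /andP[le_l lt_l] := trunc_log_bounds (isT : 1 < 2)%N (ltnW N2).
exists (trunc_log 2 (nfloor q)); split.
  by rewrite trunc_log_gt0.
have := INR_leq le_l; have := INR_leq lt_l; rewrite S_INR !INR_exp2; lra.
Qed.

Theorem mainTheorem8 :
  exists C : R,
    forall (n : nat) (w : 'I_n -> R) (theta m : R),
      is_theta_m_LTF w theta m ->
      2 * m <= theta ->
      Rlin_le (ltf w theta) (1 / 3) (C * (theta / m) * ln (theta / m)).
Proof.
have ln2_gt0 : 0 < ln 2 by rewrite -ln_1; apply: ln_increasing; lra.
(* As [1 <= l], the length [(4 * l + 11) * 8 * 2 ^ l] is at most [120 * l * 2 ^ l]; then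
   [2 ^ l <= q] bounds both factors, and [ln 2] converts the binary logarithm to the natural one. *)
exists (120 / ln 2) => n w theta m LTF m_le; have m0 : 0 < m by case: LTF => _ [].
set q := theta / m; have qE : theta = q * m by rewrite /q; field; lra.
have q2 : 2 <= q by apply: (Rmult_le_reg_r m) => //; lra.
have [l [l0 [le_q q_le]]] := exists_dyadic_scale q2.
exists ((4 * l + 11) * 2 ^ l.+3)%N; split.
  apply: ltf_lin_sketch LTF _ m_le; rewrite qE INR_exp2.
  by apply: Rmult_le_compat_r; [lra | exact: q_le].
have p0 : 0 < 2 ^ l by apply: pow_lt; lra.
have l_le : INR l <= ln q / ln 2.
  apply: (Rmult_le_reg_r (ln 2)) => //.
  rewrite /Rdiv Rmult_assoc Rinv_l ?Rmult_1_r; last lra.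
  rewrite -ln_pow; last lra.
  by case: le_q => [lt|->]; [apply/Rlt_le/ln_increasing | exact: Rle_refl].
have l1 : 1 <= INR l by apply: (INR_leq l0).
have -> : 120 / ln 2 * q * ln q = 120 * (ln q / ln 2) * q by field; lra.
have kE : INR ((4 * l + 11) * 2 ^ l.+3)%N = (4 * INR l + 11) * (8 * 2 ^ l).
  rewrite INR_muln INR_addn INR_muln INR_exp2 (INR_IZR_INZ 4) (INR_IZR_INZ 11).
  by rewrite -[l.+3]/(3 + l)%nat pow_add; ring.
rewrite kE.
apply: (Rle_trans _ (120 * INR l * 2 ^ l)); first nra.
by apply: Rmult_le_compat; nra.
Qed.
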